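(* Fix a point $x\in(0,1)$ and let $\hat m_\nu(x)$ be the local polynomial estimator of order $p$ of $m^{(\nu)}(x)$ described in the context. Assume: (A1) The kernel $K$ is a Lipschitz-continuous, symmetric density function with support $[-1,1]$. (A2) The bandwidth $h=h(\nu,n,N)>0$ satisfies $h\to0$, $Nh^2\to\infty$ and $nh^{2\nu}\to\infty$ as $n,N\to\infty$. (A3) The regression function $m$ has $p+2$ continuous derivatives on $[0,1]$. (A4) The sampling density is $f\equiv1$ on $[0,1]$. (A5) The covariance function $\rho$ is continuous on $[0,1]^2$ and has continuous first-order partial derivatives off the main diagonal; these derivatives have left and right limits on the main diagonal determined by $\rho^{(0,1)}(x,x^-)=\lim_{y\nearrow x}\rho^{(0,1)}(x,y)$ and $\rho^{(0,1)}(x,x^+)=\lim_{y\searrow x}\rho^{(0,1)}(x,y)$. Assume further that $\alpha(x):=\rho^{(0,1)}(x,x^-)-\rho^{(0,1)}(x,x^+)>0$. 1. (Local constant or linear estimation of $m$: $\nu=0$, $p\in\{0,1\}$.) If $m''(x)\ne0$ and $Nn^{-2/3}\to\infty$ as $n,N\to\infty$, then the optimal bandwidth for the asymptotic MSE of $\hat m_0(x)$ is $$h_{opt}=\left(\frac{\alpha(x)}{2\mu_2^2\,m''(x)^2}\iint_{\mathbb R^2}|u-v|K(u)K(v)\,du\,dv\right)^{1/3}n^{-1/3}.$$ 2. (Local linear or quadratic estimation of $m'$: $\nu=1$, $p\in\{1,2\}$.) If $m^{(3)}(x)\ne0$ and $Nn^{-2/5}\to\infty$ as $n,N\to\infty$,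 then the optimal bandwidth for the asymptotic MSE of $\hat m_1(x)$ is $$h_{opt}=\left(-\frac{9\,\alpha(x)}{2\mu_4^2\,m^{(3)}(x)^2}\iint_{\mathbb R^2}|u-v|\,uv\,K(u)K(v)\,du\,dv\right)^{1/5}n^{-1/5}.$$
   Context: Model. One observes $Y_i(x_j)=m(x_j)+\varepsilon_i(x_j)$, $i=1,\dots,n$, $j=1,\dots,N$, where $m:[0,1]\to\mathbb R$ is a (non-random) regression function and $\varepsilon_1,\dots,\varepsilon_n$ are i.i.d. stochastic processes on $[0,1]$ with mean zero and covariance function $\rho(y,z)=\mathbb E[\varepsilon_i(y)\varepsilon_i(z)]$. The design points $x_j=x_{j,N}$ are determined by a continuous positive probability density $f$ on $[0,1]$ through $\int_0^{x_j}f(t)\,dt=\frac{j-1}{N-1}$; for $f\equiv1$ this is the equidistant design $x_j=\frac{j-1}{N-1}$. Estimator. Let $\bar Y_{\cdot j}=\frac1n\sum_{i=1}^nY_i(x_j)$. Given a bandwidth $h>0$ and a kernel $K$, let $\hat{\boldsymbol\beta}(x)=(\hat\beta_0(x),\dots,\hat\beta_p(x))$ be the solution of $\min_{\beta_0,\dots,\beta_p}\sum_{j=1}^N\left(\bar Y_{\cdot j}-\sum_{k=0}^p\beta_k(x_j-x)^k\right)^2\frac1hK\left(\frac{x_j-x}{h}\right)$. The local polynomial estimator of order $p$ of $m^{(\nu)}(x)$ is $\hat m_\nu(x)=\nu!\,\hat\beta_\nu(x)$. Notation. $\rho^{(a,b)}$ denotes the partial derivative of order $a$ in the first and $b$ in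 the second variable. $\mu_k=\int_{-1}^1u^kK(u)\,du$; $\mathbf c=(\mu_{p+1},\dots,\mu_{2p+1})'$, $\tilde{\mathbf c}=(\mu_{p+2},\dots,\mu_{2p+2})'$. With indices $k,l=0,\dots,p$: $\mathbf S=(\mu_{k+l})$, $\tilde{\mathbf S}=(\mu_{k+l+1})$, $\mathbf S^\ast=(\mu_k\mu_l)$, $\mathbf A=\left(\frac12\iint_{[-1,1]^2}|u-v|u^kv^lK(u)K(v)\,du\,dv\right)$. $(\mathbf e_k)_{k=0,\dots,p}$ is the canonical basis of $\mathbb R^{p+1}$; a prime on a vector or matrix denotes transpose. Asymptotic MSE. $\mathrm{MSE}=\mathbb E(\hat m_\nu(x)-m^{(\nu)}(x))^2=\mathrm{Bias}(\hat m_\nu(x))^2+\mathrm{Var}(\hat m_\nu(x))$. The asymptotic MSE is the function of $h>0$ equal to $b(h)^2+v(h)$, where $b(h)$ and $v(h)$ are the second-order asymptotic expansions of bias and variance without their remainder terms: $$b(h)=\frac{\nu!\,m^{(p+1)}(x)}{(p+1)!}(\mathbf e_\nu'\mathbf S^{-1}\mathbf c)h^{p+1-\nu}+\nu!\left\{\frac{m^{(p+2)}(x)}{(p+2)!}\mathbf e_\nu'\mathbf S^{-1}\tilde{\mathbf c}+\frac{m^{(p+1)}(x)}{(p+1)!}\frac{f'(x)}{f(x)}\left(\mathbf e_\nu'\mathbf S^{-1}\tilde{\mathbf c}-\mathbf e_\nu'\mathbf S^{-1}\tilde{\mathbf S}\mathbf S^{-1}\mathbf c\right)\right\}h^{p+2-\nu},$$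 $$v(h)=\frac{(\nu!)^2\rho(x,x)}{nh^{2\nu}}\mathbf e_\nu'\mathbf S^{-1}\mathbf S^\ast\mathbf S^{-1}\mathbf e_\nu-\frac{(\nu!)^2\alpha(x)}{nh^{2\nu-1}}\mathbf e_\nu'\mathbf S^{-1}\mathbf A\mathbf S^{-1}\mathbf e_\nu .$$ The optimal bandwidth for the asymptotic MSE is the $h>0$ minimizing $b(h)^2+v(h)$. *)

(* Defs.v *)
From HB Require Import structures.
From mathcomp Require Export all_boot all_order all_algebra.
From mathcomp Require Export all_classical all_reals all_analysis.
Export Order.TTheory GRing.Theory Num.Theory.
Export numFieldNormedType.Exports.

Global Set Implicit Arguments.
Global Unset Strict Implicit.
Global Unset Printing Implicit Defensive.

Global Open Scope classical_set_scope.
Global Open Scope ring_scope.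

Section Calculus.
Context {R : realType}.

Definition I01 : set R := `[0, 1].

(* The difference quotient is taken inside D, so that at an endpoint of an
   interval D this is the one-sided derivative. *)
Definition is_derive_in (D : set R) (g : R -> R) (t l : R) : Prop :=
  (fun s => (g s - g t) / (s - t)) @ within D t^' --> l.

(* g has r continuous derivatives on D, the k-th one being dg k *)
Definition Cn_on (D : set R) (r : nat) (g : R -> R) : Prop :=
  exists dg : nat -> R -> R,
    [/\ forall t, D t -> dg 0%N t = g t,
        forall k t, (k < r)%N -> D t -> is_derive_in D (dg k) t (dg k.+1 t) &
        forall k, (k <= r)%N -> {within D, continuous (dg k)}].

Definition unit_square : set (R * R) := I01 `*` I01.

Definition off_diagonal : set (R * R) :=
  [set z | unit_square z /\ z.1 <> z.2].

(* rho^(0,1)(y, z); only evaluated at z in ]0, 1[ *)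
Definition partial01 (rho : R -> R -> R) (y z : R) : R := derive1 (rho y) z.

(* The one-sided diagonal limits of rho^(1,0) (in its first variable) are those
   of rho^(0,1), covariance functions being symmetric. *)
Definition covariance_regularity (rho : R -> R -> R) : Prop :=
  [/\ {within unit_square, continuous (fun z : R * R => rho z.1 z.2)},
      exists r10 r01 : R -> R -> R,
        [/\ forall y z, off_diagonal (y, z) ->
              is_derive_in I01 (rho ^~ z) y (r10 y z) /\
              is_derive_in I01 (rho y) z (r01 y z),
            {within off_diagonal, continuous (fun z : R * R => r10 z.1 z.2)} &
            {within off_diagonal, continuous (fun z : R * R => r01 z.1 z.2)}],
      forall t : R, 0 < t <= 1 -> cvg (partial01 rho t y @[y --> t^'-]) &
      forall t : R, 0 <= t < 1 -> cvg (partial01 rho t y @[y --> t^'+])].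

Definition alpha (rho : R -> R -> R) (t : R) : R :=
  lim (partial01 rho t y @[y --> t^'-]) - lim (partial01 rho t y @[y --> t^'+]).

Local Notation leb := (@lebesgue_measure R).

Definition kernel_assumption (K : R -> R) : Prop :=
  [/\ exists L : R, L.-lipschitz K,
      forall u, K (- u) = K u,
      forall u, 0 <= K u,
      (\int[leb]_u (K u)%:E)%E = 1%E &
      closure [set u | K u != 0] = `[-1, 1]%classic].

Definition sampling_density (f : R -> R) : Prop :=
  [/\ {within I01, continuous f},
      forall t, I01 t -> 0 < f t &
      \int[leb]_(t in I01) f t = 1].

(* Design points are indexed from 0: xd j stands for x_{j+1}. *)
Definition design (f : R -> R) (N : nat) (xd : nat -> R) : Prop :=
  forall j, (j < N)%N ->
    I01 (xd j) /\ \int[leb]_(t in `[0, xd j]) f t = j%:R / (N.-1)%:R.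

End Calculus.

Section Model.
Context {R : realType} {d : measure_display} {T : measurableType d}.
Variable P : probability T R.

(* The product sigma-algebra of R^[0,1], on functions seen through their values
   on [0, 1]. *)
Definition cylinder_sigma_algebra : set (set (R -> R)) :=
  <<s [set C | exists t (B : set R),
         [/\ I01 t, measurable B & C = [set g | B (g t)]]]>>.

Definition sample_path (e : R -> {RV P >-> R}) (w : T) : R -> R :=
  fun t => e t w.

(* Independence and identical distribution are those of the paths, as random
   elements of (R^[0,1], cylinder_sigma_algebra). *)
Definition iid_processes (eps : nat -> R -> {RV P >-> R}) : Prop :=
  (forall (J : seq nat) (A : nat -> set (R -> R)), uniq J ->
     (forall i, cylinder_sigma_algebra (A i)) ->
     P (\bigcap_(i in [set` J]) (sample_path (eps i) @^-1` A i)) =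
     (\prod_(i <- J) P (sample_path (eps i) @^-1` A i))%E) /\
  (forall i (A : set (R -> R)), cylinder_sigma_algebra A ->
     P (sample_path (eps i) @^-1` A) = P (sample_path (eps 0%N) @^-1` A)).

Definition error_model (eps : nat -> R -> {RV P >-> R}) (rho : R -> R -> R) :
    Prop :=
  [/\ iid_processes eps,
      forall i t, I01 t ->
        P.-integrable setT (fun w => ((eps i t w) ^+ 2)%:E),
      forall i t, I01 t -> ('E_P[eps i t])%E = 0%E &
      forall i y z, I01 y -> I01 z ->
        ('E_P[fun w => (eps i y w * eps i z w)%R])%E = (rho y z)%:E].

Definition observation (m : R -> R) (eps : nat -> R -> {RV P >-> R})
    (i : nat) (t : R) (w : T) : R := m t + eps i t w.

Definition mean_observation (m : R -> R) (eps : nat -> R -> {RV P >-> R})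
    (n : nat) (xd : nat -> R) (w : T) (j : nat) : R :=
  n%:R^-1 * \sum_(i < n) observation m eps i (xd j) w.

End Model.

Section Estimator.
Context {R : realType}.

Definition wls_criterion (K : R -> R) (p N : nat) (xd Ybar : nat -> R)
    (h x : R) (beta : 'rV[R]_p.+1) : R :=
  \sum_(j < N)
    (Ybar j - \sum_(k < p.+1) beta 0 k * (xd j - x) ^+ k) ^+ 2
      * (h^-1 * K ((xd j - x) / h)).

Definition is_locpoly_estimate (K : R -> R) (p N : nat) (xd Ybar : nat -> R)
    (h : R) (nu : 'I_p.+1) (x est : R) : Prop :=
  exists beta : 'rV[R]_p.+1,
    (forall gamma : 'rV[R]_p.+1,
       wls_criterion K N xd Ybar h x beta <=
       wls_criterion K N xd Ybar h x gamma) /\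
    est = nu`!%:R * beta 0 nu.

End Estimator.

Section AsymptoticMSE.
Context {R : realType}.
Local Notation leb := (@lebesgue_measure R).
Variables (K : R -> R) (p : nat).

Definition kmoment (k : nat) : R := \int[leb]_(u in `[-1, 1]) (u ^+ k * K u).

Definition cvec : 'cV[R]_p.+1 := \col_k kmoment (p.+1 + k).
Definition ctvec : 'cV[R]_p.+1 := \col_k kmoment (p.+2 + k).
Definition Smx : 'M[R]_p.+1 := \matrix_(k, l) kmoment (k + l).
Definition Stmx : 'M[R]_p.+1 := \matrix_(k, l) kmoment (k + l + 1).
Definition Sstarmx : 'M[R]_p.+1 := \matrix_(k, l) (kmoment k * kmoment l).
Definition Amx : 'M[R]_p.+1 := \matrix_(k, l)
  (2^-1 * \int[(leb \x leb)%E]_(z in `[-1, 1] `*` `[-1, 1])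
            (`|z.1 - z.2| * z.1 ^+ k * z.2 ^+ l * K z.1 * K z.2)).

Definition evec (nu : 'I_p.+1) : 'cV[R]_p.+1 := delta_mx nu 0.
Definition to_scalar (M : 'M[R]_1) : R := M 0 0.

Variables (m f : R -> R) (rho : R -> R -> R) (nu : 'I_p.+1) (x : R) (n : nat).

Local Notation e := (evec nu).
Local Notation Si := (invmx Smx).

Definition asymptotic_bias (h : R) : R :=
  nu`!%:R * derive1n p.+1 m x / (p.+1)`!%:R
    * to_scalar (e^T *m Si *m cvec) * h ^+ (p.+1 - nu)
  + nu`!%:R *
    (derive1n p.+2 m x / (p.+2)`!%:R * to_scalar (e^T *m Si *m ctvec)
     + derive1n p.+1 m x / (p.+1)`!%:R * (derive1 f x / f x)
       * (to_scalar (e^T *m Si *m ctvec)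
          - to_scalar (e^T *m Si *m Stmx *m Si *m cvec)))
    * h ^+ (p.+2 - nu).

(* The exponent 2 nu - 1 is an integer, equal to -1 for nu = 0. *)
Definition asymptotic_variance (h : R) : R :=
  nu`!%:R ^+ 2 * rho x x / (n%:R * h ^+ (2 * nu))
    * to_scalar (e^T *m Si *m Sstarmx *m Si *m e)
  - nu`!%:R ^+ 2 * alpha rho x / (n%:R * h ^ (2 * nu%:Z - 1))
    * to_scalar (e^T *m Si *m Amx *m Si *m e).

Definition asymptotic_MSE (h : R) : R :=
  asymptotic_bias h ^+ 2 + asymptotic_variance h.

End AsymptoticMSE.

Section OptimalBandwidth.
Context {R : realType}.

(* "the" minimizer: h is the unique global minimum point on ]0, +oo[ *)
Definition is_optimal_bandwidth (M : R -> R) (h : R) : Prop :=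
  0 < h /\ forall g, 0 < g -> g != h -> M h < M g.

Definition plane_integral (F : R -> R -> R) : R :=
  \int[(@lebesgue_measure R \x @lebesgue_measure R)%E]_(z in setT) F z.1 z.2.

End OptimalBandwidth.

(* Main.v *)
Require Import Defs.
From mathcomp Require Import all_boot all_order all_algebra.
From mathcomp Require Import all_classical all_reals all_analysis.
From mathcomp Require Import measurable_realfun ring lra.

(* For f = 1 the term in f'/f vanishes, and since the odd moments of K are zero
   and p is nu or nu + 1, e_nu is an eigenvector of S with eigenvalue mu_(2 nu).
   The asymptotic MSE therefore reduces to a h^4 - b h + const for nu = 0 and to
   a h^4 + b / h for nu = 1; both have a unique minimum point as soon as
   a, b > 0.  The sign of b is that of the double integral for nu = 0.  For
   nu = 1 the reflection v |-> - v gives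
     2 \iint |u - v| u v K K = \iint (|u - v| - |u + v|) u v K K,
   whose integrand is nonpositive. *)

(** * Strict positivity of integrals *)

Section StrictPositivity.
Context {R : realType} {d : measure_display} {T : measurableType d}.
Variable mu : {measure set T -> \bar R}.

(** A nonnegative integrand with zero integral vanishes almost everywhere, which would make [A]
    negligible. *)
Lemma Rintegral_gt0 (D A : set T) (g : T -> R) :
  measurable D -> measurable A -> A `<=` D -> mu.-integrable D (EFin \o g) ->
  (forall t, D t -> 0 <= g t) -> (forall t, A t -> 0 < g t) -> (0 < mu A)%E ->
  0 < \int[mu]_(t in D) g t.
Proof.
move=> mD mA AD ig g0 gA muA; rewrite lt_neqAle Rintegral_ge0 // andbT.
apply/negP => /eqP int0.
have : (\int[mu]_(t in D) `|(EFin \o g) t|)%E = 0%E.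
  transitivity (\int[mu]_(t in D) (g t)%:E)%E.
    by apply: eq_integral => t /set_mem Dt /=; rewrite ger0_norm// g0.
  by rewrite -(fineK (integrable_fin_num mD ig)); congr (_%:E).
move/(ae_eq_integral_abs _ mD (measurable_int _ ig)) => gae0.
have /measure_negligible : mu.-negligible A.
  apply: negligibleS gae0 => t At /= /(_ (AD _ At)) [gt0].
  by have := gA _ At; rewrite gt0 ltxx.
by move=> /(_ mA) muA0; rewrite muA0 ltxx in muA.
Qed.

End StrictPositivity.

(** * Change of variables along a measure-preserving map *)

Section MeasurePreserving.
Context {R : realType} {d : measure_display} {T : measurableType d}.
Variables (mu : {measure set T -> \bar R}) (phi : T -> T).
Hypothesis mphi : measurable_fun setT phi.
Hypothesis phimu : forall A, measurable A -> mu (phi @^-1` A) = mu A.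

Lemma Rintegral_measure_preserving (D : set T) (g : T -> R) :
  measurable D -> phi @^-1` D = D -> measurable_fun setT g ->
  mu.-integrable D (EFin \o (g \o phi)) ->
  \int[mu]_(t in D) g (phi t) = \int[mu]_(t in D) g t.
Proof.
move=> mD DN mg ig; rewrite /Rintegral; congr fine.
transitivity (\int[pushforward mu phi]_(t in D) (EFin \o g) t)%E.
  rewrite integral_pushforward ?DN //; exact/measurable_EFinP.
by apply: eq_measure_integral => // A mA _; exact: phimu.
Qed.

End MeasurePreserving.

(** * Lebesgue measure of open sets, and reflection of one coordinate of the plane *)

Section LebesgueMeasure.
Context {R : realType}.
Local Notation mR := (measurableTypeR R).
Local Notation leb := (@lebesgue_measure R).

Lemma lebesgue_open_gt0 (U : set R) : open U -> U !=set0 -> (0 < leb U)%E.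
Proof.
move=> oU [t /(open_subball oU)[e /= e0 eU]].
(* [eU] covers only positive radii strictly below [e], hence the half. *)
apply: (@lt_le_trans _ _ (leb (ball t (e / 2)))); last first.
  apply: le_measure; rewrite ?inE;
    [exact: measurable_ball|exact: open_measurable|].
  apply: eU => //=; rewrite /ball_ /= ?sub0r ?normrN ?gtr0_norm; lra.
by rewrite lebesgue_measure_ball ?lte_fin; lra.
Qed.

Definition reflect2 (z : mR * mR) : mR * mR := (z.1, - (z.2 : R)).

Lemma measurable_reflect2 : measurable_fun setT reflect2.
Proof.
apply/measurable_fun_pair; first exact: measurable_fst.
by apply: measurableT_comp measurable_snd; exact: oppr_measurable.
Qed.

(** By uniqueness of the product measure, it is enough to compare the image measure [nu] with the
    product on rectangles, where invariance of Lebesgue measure under negation applies to the second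
    side. *)
Lemma lebesgue_prod_reflect2 (A : set (mR * mR)) : measurable A ->
  (leb \x leb)%E (reflect2 @^-1` A) = (leb \x leb)%E A.
Proof.
move=> mA; pose nu : {measure set (mR * mR) -> \bar R} :=
  measure_function_pushforward__canonical__measure_function_Measure
    (leb \x leb)%E measurable_reflect2.
apply/esym/(@product_measure_unique _ _ mR mR R leb leb nu) => // B C mB mC.
have -> : nu (B `*` C) = (leb \x leb)%E (B `*` (-%R @^-1` C)) by [].
rewrite product_measure1E //; last first.
  by rewrite -[X in measurable X]setTI; exact: oppr_measurable.
by congr (_ * _)%E; exact: lebesgue_measureN.
Qed.

End LebesgueMeasure.

(** * Positivity, parity and sign of the kernel moments *)

Section KernelMoments.
Local Open Scope classical_set_scope.
Local Open Scope ring_scope.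
Context {R : realType}.
Variable K : R -> R.
Hypothesis hK : kernel_assumption K.
Local Notation leb := (@lebesgue_measure R).
Local Notation mR := (measurableTypeR R).
Local Notation I := (`[-1, 1]%classic : set R).
Local Notation mu := (kmoment K).

Local Notation supp := [set u : R | K u != 0].

Lemma kernel_ge0 u : 0 <= K u. Proof. by case: hK. Qed.

Lemma kernel_sym u : K (- u) = K u. Proof. by case: hK. Qed.

Lemma kernel_supp u : K u != 0 -> I u.
Proof. by case: hK => _ _ _ _ <- Ku; exact: subset_closure. Qed.

Lemma kernel_continuous : continuous K.
Proof.
case: hK => -[L lipK] _ _ _ _ u; apply/cvgrPdist_le => e e0.
near=> v.
have := lipK (u, v) (conj Logic.I Logic.I); rewrite /self_sub /=.
move/le_trans; apply.
(* [L] is not known to be positive; [|L| + 1] is a Lipschitz constant by which one can divide. *)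
apply: (@le_trans _ _ ((`|L| + 1) * `|u - v|)).
  by apply: ler_wpM2r => //; have := ler_norm L; lra.
rewrite -ler_pdivlMl; last by have := normr_ge0 L; lra.
near: v; apply: cvgr_dist_le; first exact: cvg_id.
by rewrite mulr_gt0 // invr_gt0; have := normr_ge0 L; lra.
Unshelve. all: by end_near. Qed.

Lemma kernel_measurable : measurable_fun setT K.
Proof. exact: continuous_measurable_fun kernel_continuous. Qed.

(** [K] vanishes off [-1, 1], and on it the Lipschitz bound from the origin gives [K 0 + |L|]. *)
Lemma kernel_bounded : exists C, forall u, K u <= C.
Proof.
have [L lipK] : exists L, L.-lipschitz K by case: hK.
exists (K 0 + `|L|) => u; have [->|] := eqVneq (K u) 0.
  by rewrite addr_ge0 // kernel_ge0.
move=> /kernel_supp; rewrite /= in_itv /= => u1.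
have := lipK (u, 0) (conj Logic.I Logic.I); rewrite /self_sub /= subr0 => lip.
suff : L * `|u| <= `|L| by move: lip; rewrite ler_norml; lra.
have -> : `|L| = `|L| * 1 by rewrite mulr1.
apply: (le_trans (ler_norm _)); rewrite normrM normr_id ler_wpM2l //.
by rewrite ler_norml; lra.
Qed.

Lemma kernel_open : open supp.
Proof.
have -> : supp = K @^-1` [set y | y != 0] by [].
apply: open_comp; first by move=> u _; exact: kernel_continuous.
exact: open_neq.
Qed.

(** [K] may vanish inside [-1, 1], but the set where it does not is open and has closure [-1, 1]. It
    therefore meets every open interval around a point [c] of [-1, 1], endpoints included, in a
    nonempty open set. *)
Lemma kernel_mass_gt0 (a b c : R) : a < c < b -> I c ->
  (0 < leb (supp `&` `]a, b[%classic))%E.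
Proof.
move=> acb Ic; apply: lebesgue_open_gt0.
  by apply: openI; [exact: kernel_open|exact: interval_open].
have : closure supp c by case: hK => _ _ _ _ ->.
apply; apply: open_nbhs_nbhs; split; first exact: interval_open.
by rewrite /= in_itv.
Qed.

Lemma kernel_moment_integrable k :
  leb.-integrable I (EFin \o (fun u => u ^+ k * K u)).
Proof.
apply: continuous_compact_integrable; first exact: segment_compact.
apply: continuous_subspaceT => u.
apply: (@continuousM R mR (fun u : R => u ^+ k) K u).
  exact: exprn_continuous.
exact: kernel_continuous.
Qed.

Lemma kernel_moment0 : mu 0 = 1.
Proof.
have [_ _ _ K1 _] := hK; rewrite /kmoment.
transitivity (\int[leb]_u K u); last by rewrite /Rintegral K1.
rewrite Rintegral_mkcond; apply: eq_Rintegral => u _; rewrite patchE.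
case: ifPn => [|/negP nIu]; first by rewrite expr0 mul1r.
have [-> //|Ku] := eqVneq (K u) 0.
by case: nIu; exact/mem_set/kernel_supp.
Qed.

(** The reflection u |-> - u preserves [-1, 1] and the measure, and changes the sign of the
    integrand. *)
Lemma kernel_moment_odd k : odd k -> mu k = 0.
Proof.
move=> kodd; suff : mu k = - mu k by lra.
have parity u : (- u) ^+ k * K (- u) = -1 * (u ^+ k * K u).
  by rewrite kernel_sym exprNn -signr_odd kodd; ring.
rewrite {1}/kmoment.
rewrite -(@Rintegral_measure_preserving _ _ mR leb (-%R : mR -> mR)).
- transitivity (\int[leb]_(u in I) (-1 * (u ^+ k * K u))).
    by apply: eq_Rintegral => u _; exact: parity.
  rewrite RintegralZl ?mulN1r //; exact: kernel_moment_integrable.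
- exact: oppr_measurable.
- by move=> A mA; exact: lebesgue_measureN.
- exact: measurable_itv.
- by apply/seteqP; split => u /=; rewrite !in_itv /=; lra.
- by apply: measurable_funM; [exact: measurable_funX|exact: kernel_measurable].
- rewrite (_ : EFin \o _ = fun u => ((-1)%:E * (u ^+ k * K u)%:E)%E).
    by apply: integrableZl => //; exact: kernel_moment_integrable.
  by apply/funext => u /=; rewrite -EFinM; congr EFin; exact: parity.
Qed.

Lemma kernel_moment_gt0 k : ~~ odd k -> 0 < mu k.
Proof.
move=> keven.
(* A neighbourhood of the endpoint 1 of the support stays away from the zero of u ^ k. *)
apply: (@Rintegral_gt0 _ _ mR leb _ (supp `&` `]2^-1, 2[)).
- exact: measurable_itv.
- apply: open_measurable; apply: openI; first exact: kernel_open.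
  exact: interval_open.
- by move=> u [/kernel_supp].
- exact: kernel_moment_integrable.
- by move=> u _; rewrite mulr_ge0 ?kernel_ge0 ?exprn_even_ge0.
- move=> u [Ku /=]; rewrite in_itv /= => u2.
  rewrite mulr_gt0 //; last by rewrite lt_neqAle eq_sym Ku kernel_ge0.
  by rewrite exprn_gt0 //; lra.
- by apply: (@kernel_mass_gt0 _ _ 1); rewrite /= ?in_itv /=; lra.
Qed.

(** The difference is the variance of u ^ 2 under the density [K], that is, the integral of (u ^ 2 -
    mu_2) ^ 2 K(u). It is positive because u ^ 2 is not almost surely constant. *)
Lemma kernel_moment_variance : mu 2 ^+ 2 < mu 4.
Proof.
have mI : measurable (I : set mR) by exact: measurable_itv.
have iZ c k := integrableZl mI c (kernel_moment_integrable k).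
have iB := integrableB mI (iZ 1 4) (iZ (2 * mu 2) 2).
have iD := integrableD mI iB (iZ (mu 2 ^+ 2) 0%N).
(* The square is expanded into scaled moment integrands; the factor 1 and the power 0 give the three
   terms a common shape. *)
pose g u := 1 * (u ^+ 4 * K u) - 2 * mu 2 * (u ^+ 2 * K u)
            + mu 2 ^+ 2 * (u ^+ 0 * K u).
have gE u : g u = (u ^+ 2 - mu 2) ^+ 2 * K u by rewrite /g; ring.
have muE : \int[leb]_(u in I) g u = mu 4 - mu 2 ^+ 2.
  rewrite RintegralD //; last exact: iZ.
  rewrite RintegralB //; [|exact: iZ|exact: iZ].
  rewrite 3?RintegralZl //; try exact: kernel_moment_integrable.
  transitivity (1 * mu 4 - 2 * mu 2 * mu 2 + mu 2 ^+ 2 * mu 0); first by [].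
  rewrite kernel_moment0; ring.
rewrite -subr_gt0 -muE.
have pos a b c (A := supp `&` `]a, b[) : a < c < b -> I c ->
    (forall u, a < u < b -> u ^+ 2 != mu 2) -> 0 < \int[leb]_(u in I) g u.
  move=> acb Ic ab2; apply: (@Rintegral_gt0 _ _ mR leb _ A) => //.
  - apply: open_measurable; apply: openI; first exact: kernel_open.
    exact: interval_open.
  - by move=> u [/kernel_supp].
  - by move=> u _; rewrite gE mulr_ge0 ?kernel_ge0 ?sqr_ge0.
  - move=> u [Ku /=]; rewrite in_itv /= gE => uab.
    rewrite mulr_gt0 //; last by rewrite lt_neqAle eq_sym Ku kernel_ge0.
    by rewrite lt_neqAle sqr_ge0 andbT eq_sym expf_neq0 // subr_eq0 ab2.
  - exact: (kernel_mass_gt0 acb Ic).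
(* The set of positivity must avoid the zeros of u ^ 2 - mu_2: near 1, u ^ 2 exceeds 1/4; near 0, it
   is below 1/4. *)
have [mu2 | mu2] := lerP (mu 2) 4^-1.
  apply: (pos 2^-1 2 1); rewrite /= ?in_itv /=; try lra.
  by move=> u u2; apply/eqP => u2E; nra.
apply: (pos (- 2^-1) 2^-1 0); rewrite /= ?in_itv /=; try lra.
by move=> u u2; apply/eqP => u2E; nra.
Qed.

(** Twice the diagonal entry (k, k) of [Amx]. Only the entry (nu, nu) survives in the variance once
    e_nu is an eigenvector of S. *)
Definition kernel_abs_moment (k : nat) : R :=
  \int[(leb \x leb)%E]_(z in I `*` I)
    (`|z.1 - z.2| * z.1 ^+ k * z.2 ^+ k * K z.1 * K z.2).

(** The integrand is measurable and bounded, as [K] is bounded, and the square has finite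
    measure. *)
Lemma box_integrable (g : mR * mR -> R) : measurable_fun setT g ->
  (exists B, forall z, (I `*` I) z -> `|g z| <= B) ->
  (leb \x leb)%E.-integrable (I `*` I) (EFin \o (fun z => g z * K z.1 * K z.2)).
Proof.
move=> mg [B gB]; have [C KC] := kernel_bounded.
apply: measurable_bounded_integrable.
- by apply: measurableX; exact: measurable_itv.
- have mI : measurable (I : set mR) by exact: measurable_itv.
  have lI : leb I = 2%:E.
    by rewrite lebesgue_measure_itv /= lte_fin ifT; [congr EFin|]; lra.
  apply: (@le_lt_trans _ _ (leb I * leb I)%E); last by rewrite lI -EFinM ltry.
  by rewrite -(product_measure1E leb leb mI mI).
- apply: measurable_funTS.
  apply: measurable_funM; first apply: measurable_funM => //.
  + by apply: measurableT_comp kernel_measurable measurable_fst.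
  + by apply: measurableT_comp kernel_measurable measurable_snd.
- exists (B * C * C); split; first exact: num_real.
  move=> y yB z Iz; apply: le_trans (ltW yB).
  rewrite !normrM !(ger0_norm (kernel_ge0 _)).
  have := normr_ge0 (g z); have := gB z Iz.
  have := kernel_ge0 z.1; have := KC z.1.
  have := kernel_ge0 z.2; have := KC z.2.
  by move=> *; rewrite !ler_pM // mulr_ge0.
Qed.

Lemma measurable_supp_itv a b : measurable (supp `&` `]a, b[ : set mR).
Proof.
apply: open_measurable; apply: openI; first exact: kernel_open.
exact: interval_open.
Qed.

Lemma measurable_absX k :
  measurable_fun setT
    (fun z : mR * mR => `|z.1 - z.2| * z.1 ^+ k * z.2 ^+ k : R).
Proof.
apply: measurable_funM; first apply: measurable_funM.
- apply: measurableT_comp => //; apply: measurable_funB.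
    exact: measurable_fst.
  exact: measurable_snd.
- by apply: measurable_funX; exact: measurable_fst.
- by apply: measurable_funX; exact: measurable_snd.
Qed.

Lemma absX_bounded k (u v : R) : I u -> I v ->
  `| `|u - v| * u ^+ k * v ^+ k| <= 2.
Proof.
rewrite /= !in_itv /= => Iu Iv; rewrite !normrM normr_id !normrX.
have -> : 2 = 2 * 1 * 1 :> R by ring.
rewrite !ler_pM // ?mulr_ge0 ?exprn_ge0 //.
- by rewrite ler_norml; lra.
- by rewrite exprn_ile1 // ler_norml; lra.
- by rewrite exprn_ile1 // ler_norml; lra.
Qed.

(** The factor |u - v| vanishes on the diagonal, so positivity is tested on a product of two
    disjoint sets of positive measure, one near 1 and one near 0. *)
Lemma kernel_abs_moment0_gt0 : 0 < kernel_abs_moment 0.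
Proof.
pose A := supp `&` `]2^-1, 2[; pose B := supp `&` `](- 2^-1), 2^-1[.
apply: (@Rintegral_gt0 _ _ _ (leb \x leb)%E _ (A `*` B)).
- by apply: measurableX; exact: measurable_itv.
- by apply: measurableX; exact: measurable_supp_itv.
- by move=> z [[/kernel_supp ? _] [/kernel_supp ? _]].
- apply: box_integrable; first exact: measurable_absX.
  by exists 2 => z [Iz1 Iz2]; exact: absX_bounded.
- by move=> z _; rewrite !expr0 !mulr1 !mulr_ge0 ?kernel_ge0.
- move=> z [[/= K1 +] [/= K2 +]]; rewrite !in_itv /= => z1 z2.
  rewrite !expr0 !mulr1 !mulr_gt0 //;
    try by rewrite lt_neqAle eq_sym ?K1 ?K2 kernel_ge0.
  by rewrite normr_gt0 subr_eq0; apply/eqP; lra.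
- rewrite [ltRHS](@product_measure1E _ _ mR mR R leb leb);
    try exact: measurable_supp_itv.
  rewrite mule_gt0 //.
    by apply: (@kernel_mass_gt0 _ _ 1); rewrite /= ?in_itv /=; lra.
  by apply: (@kernel_mass_gt0 _ _ 0); rewrite /= ?in_itv /=; lra.
Qed.

(** Since (u + v) ^ 2 - (u - v) ^ 2 = 4 u v, the difference of absolute values has the sign of u
    v. *)
Lemma polarization_ge0 (u v : R) : 0 <= (`|u + v| - `|u - v|) * (u * v).
Proof.
have [a0|a0] := ger0P (u + v); have [b0|b0] := ger0P (u - v); nra.
Qed.

Lemma kernel_abs_moment1_lt0 : kernel_abs_moment 1 < 0.
Proof.
pose A := supp `&` `]2^-1, 2[.
pose F (z : mR * mR) : R := `|z.1 - z.2| * z.1 ^+ 1 * z.2 ^+ 1 * K z.1 * K z.2.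
have mII : measurable (I `*` I : set (mR * mR)).
  by apply: measurableX; exact: measurable_itv.
have IN (v : R) : I (- v) <-> I v by rewrite /= !in_itv /=; lra.
have iF : (leb \x leb)%E.-integrable (I `*` I) (EFin \o F).
  apply: box_integrable; first exact: measurable_absX.
  by exists 2 => z [Iz1 Iz2]; exact: absX_bounded.
have iFr : (leb \x leb)%E.-integrable (I `*` I) (EFin \o (F \o @reflect2 R)).
  have -> : F \o @reflect2 R = fun z =>
      (`|z.1 - - z.2| * z.1 ^+ 1 * (- z.2) ^+ 1) * K z.1 * K z.2.
    by apply/funext => z; rewrite /F /= kernel_sym.
  apply: box_integrable.
    by apply: measurableT_comp (measurable_absX 1) (@measurable_reflect2 R).
  by exists 2 => z [Iz1 Iz2]; apply: absX_bounded => //; exact/IN.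
have FrE : \int[(leb \x leb)%E]_(z in I `*` I) F (reflect2 z)
           = kernel_abs_moment 1.
  apply: Rintegral_measure_preserving => //.
  - exact: measurable_reflect2.
  - exact: lebesgue_prod_reflect2.
  - by apply/seteqP; split => z [] /= ? /IN.
  - apply: measurable_funM; first apply: measurable_funM.
    + exact: measurable_absX.
    + by apply: measurableT_comp kernel_measurable measurable_fst.
    + by apply: measurableT_comp kernel_measurable measurable_snd.
(* By [FrE] this integral equals -2 [kernel_abs_moment 1]. Its integrand is nonnegative by
   polarization, and positive where both coordinates lie near 1. *)
suff : 0 < \int[(leb \x leb)%E]_(z in I `*` I) (-1 * (F (reflect2 z) + F z)).
  rewrite RintegralZl //; last exact: (integrableD mII iFr iF).
  rewrite RintegralD // FrE -/(kernel_abs_moment 1); lra.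
have GE z : -1 * (F (reflect2 z) + F z) =
    (`|z.1 + z.2| - `|z.1 - z.2|) * (z.1 * z.2) * (K z.1 * K z.2).
  by rewrite /F /= kernel_sym opprK !expr1; ring.
apply: (@Rintegral_gt0 _ _ _ (leb \x leb)%E _ (A `*` A)) => //.
- by apply: measurableX; exact: measurable_supp_itv.
- by move=> z [[/kernel_supp ? _] [/kernel_supp ? _]].
- exact: (integrableZl mII (-1) (integrableD mII iFr iF)).
- move=> z _; rewrite GE; apply: mulr_ge0;
    by rewrite ?polarization_ge0 ?mulr_ge0 ?kernel_ge0.
- move=> z [[/= K1 +] [/= K2 +]]; rewrite !in_itv /= => z1 z2.
  rewrite GE mulr_gt0 //; last first.
    by rewrite mulr_gt0 // lt_neqAle eq_sym ?K1 ?K2 kernel_ge0.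
  have z12 : 0 < z.1 * z.2 by rewrite mulr_gt0 //; lra.
  rewrite mulr_gt0 // subr_gt0 (gtr0_norm (_ : 0 < z.1 + z.2)) ?ltr_norml; lra.
- rewrite [ltRHS](@product_measure1E _ _ mR mR R leb leb);
    try exact: measurable_supp_itv.
  rewrite mule_gt0 //; apply: (@kernel_mass_gt0 _ _ 1);
    by rewrite /= ?in_itv /=; lra.
Qed.

End KernelMoments.

(** * The matrix S and the reduced form of the asymptotic MSE *)

Section AsymptoticExpansion.
Context {R : realType}.
Variable K : R -> R.
Hypothesis hK : kernel_assumption K.
Local Notation mu := (kmoment K).

Lemma plane_integral_abs_moment k :
  plane_integral (fun u v => `|u - v| * (u ^+ k * v ^+ k) * K u * K v)
  = kernel_abs_moment K k.
Proof.
rewrite /plane_integral /kernel_abs_moment [RHS]Rintegral_mkcond.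
apply: eq_Rintegral => z _; rewrite patchE mulrA; case: ifPn => // /negP nz.
have [->|Ku] := eqVneq (K z.1) 0; first by rewrite mulr0 mul0r.
have [->|Kv] := eqVneq (K z.2) 0; first by rewrite mulr0.
case: nz; apply/mem_set; split; first exact: (kernel_supp hK Ku).
exact: (kernel_supp hK Kv).
Qed.

(** As the odd moments vanish and mu_0 = 1, the determinants for p = 0, 1, 2 are 1, mu_2 and mu_2
    (mu_4 - mu_2 ^ 2). *)
Lemma Smx_unit p : (p <= 2)%N -> Smx K p \in unitmx.
Proof.
have m0 := kernel_moment0 hK; have m2 : 0 < mu 2 by exact: kernel_moment_gt0.
have m4 : mu 2 ^+ 2 < mu 4 by exact: kernel_moment_variance.
have m1 : mu 1 = 0 by exact: kernel_moment_odd.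
have m3 : mu 3 = 0 by exact: kernel_moment_odd.
case: p => [|[|[|//]]] _; rewrite unitmxE unitfE.
- by rewrite det_mx11 mxE m0 oner_eq0.
- rewrite (expand_det_row _ 0) !big_ord_recl big_ord0.
  rewrite /cofactor !det_mx11 !mxE /=.
  rewrite /bump /= m0 m1 -[mu (1 + 0 + (1 + 0))]/(mu 2).
  by rewrite (_ : _ + _ = mu 2) ?gt_eqF //; ring.
rewrite (expand_det_row _ 0) !big_ord_recl big_ord0.
rewrite /cofactor !(expand_det_row _ 0) !big_ord_recl !big_ord0.
rewrite /cofactor !det_mx11 !mxE /=.
rewrite /bump /= m0 m1 m3 !(add0n, addn0) -[mu (1 + 1 + (1 + 1))]/(mu 4).
rewrite -[mu (1 + 1)]/(mu 2).
rewrite (_ : _ + _ = mu 2 * (mu 4 - mu 2 ^+ 2)); last by ring.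
by rewrite gt_eqF // mulr_gt0 // subr_gt0.
Qed.

(** Row nu of S has entries mu_(nu + l) with l <= nu + 1. For nu <= 1, every such l other than nu
    has parity opposite to nu, so its entry is an odd moment. *)
Lemma evec_Smx p (nu : 'I_p.+1) : (nu <= 1)%N -> (p <= nu.+1)%N ->
  (evec nu)^T *m Smx K p = mu (2 * nu) *: (evec nu)^T.
Proof.
move=> nu1 pnu; apply/matrixP => i l.
rewrite trmx_delta -rowE !mxE (ord1 i) eqxx /=.
case: eqVneq => [->|lnu]; first by rewrite mulr1 addnn mul2n.
rewrite mulr0 kernel_moment_odd //.
have : (l <= nu.+1)%N by apply: leq_trans pnu; rewrite -ltnS.
move: lnu nu1; rewrite -val_eqE /=.
by case: (nu : nat) => [|[|//]]; case: (l : nat) => [|[|[|?]]].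
Qed.

Lemma invSmx_evec p (nu : 'I_p.+1) : (nu <= 1)%N -> (p <= nu.+1)%N ->
  invmx (Smx K p) *m evec nu = (mu (2 * nu))^-1 *: evec nu.
Proof.
move=> nu1 pnu; have uS : Smx K p \in unitmx
  by apply: Smx_unit; apply: leq_trans pnu _; rewrite ltnS.
have Ssym : (Smx K p)^T = Smx K p.
  by apply/matrixP => i j; rewrite !mxE addnC.
have mu_neq0 : mu (2 * nu) != 0.
  by rewrite gt_eqF // kernel_moment_gt0 // oddM.
(* The symmetry of S turns the left eigenvector into a right one. *)
have SE : Smx K p *m evec nu = mu (2 * nu) *: evec nu.
  by rewrite -[LHS]trmxK trmx_mul Ssym evec_Smx // linearZ /= trmxK.
by rewrite -[in LHS](scalerK mu_neq0 (evec nu)) -SE -scalemxAr mulKmx.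
Qed.

Lemma evec_invSmx p (nu : 'I_p.+1) : (nu <= 1)%N -> (p <= nu.+1)%N ->
  (evec nu)^T *m invmx (Smx K p) = (mu (2 * nu))^-1 *: (evec nu)^T.
Proof.
move=> nu1 pnu; have uS : Smx K p \in unitmx
  by apply: Smx_unit; apply: leq_trans pnu _; rewrite ltnS.
have mu_neq0 : mu (2 * nu) != 0.
  by rewrite gt_eqF // kernel_moment_gt0 // oddM.
rewrite -[in LHS](scalerK mu_neq0 (evec nu)^T) -evec_Smx //.
by rewrite -scalemxAl mulmxK.
Qed.

(** The eigenvector relation reduces e' S^-1 v to c v_nu and e' S^-1 M S^-1 e to c ^ 2 M_(nu, nu),
    so no matrix inverse remains. *)
Lemma asymptotic_MSE_uniform_design (m f : R -> R) (rho : R -> R -> R) p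
    (nu : 'I_p.+1) (x : R) (n : nat) (h : R) (c : R := (mu (2 * nu))^-1%R) :
  (nu <= 1)%N -> (p <= nu.+1)%N -> derive1 f x = 0 ->
  asymptotic_MSE K m f rho nu x n h =
  (nu`!%:R * derive1n p.+1 m x / (p.+1)`!%:R * (c * mu (p.+1 + nu))
     * h ^+ (p.+1 - nu)
   + nu`!%:R * (derive1n p.+2 m x / (p.+2)`!%:R * (c * mu (p.+2 + nu)))
     * h ^+ (p.+2 - nu)) ^+ 2
  + (nu`!%:R ^+ 2 * rho x x / (n%:R * h ^+ (2 * nu)) * (c ^+ 2 * mu nu ^+ 2)
     - nu`!%:R ^+ 2 * alpha rho x / (n%:R * h ^ (2 * nu%:Z - 1))
       * (c ^+ 2 * (2^-1 * kernel_abs_moment K nu))).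
Proof.
move=> nu1 pnu f0.
have scalarZ a (M : 'M[R]_1) : to_scalar (a *: M) = a * to_scalar M.
  by rewrite /to_scalar mxE.
have scalar_row (v : 'cV[R]_p.+1) : to_scalar ((evec nu)^T *m v) = v nu 0.
  by rewrite /to_scalar trmx_delta -rowE mxE.
have scalar_col (M : 'M[R]_p.+1) :
    to_scalar ((evec nu)^T *m M *m evec nu) = M nu nu.
  by rewrite -mulmxA scalar_row -colE mxE.
have bias (v : 'cV[R]_p.+1) :
    to_scalar ((evec nu)^T *m invmx (Smx K p) *m v) = c * v nu 0.
  by rewrite evec_invSmx // -scalemxAl scalarZ scalar_row.
have var (M : 'M[R]_p.+1) :
    to_scalar ((evec nu)^T *m invmx (Smx K p) *m M *m invmx (Smx K p)
               *m evec nu)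
    = c ^+ 2 * M nu nu.
  rewrite -mulmxA invSmx_evec // evec_invSmx // -!scalemxAl -scalemxAr.
  by rewrite !scalarZ scalar_col mulrA -expr2.
rewrite /asymptotic_MSE /asymptotic_bias /asymptotic_variance !bias !var !mxE.
by rewrite f0 mul0r mulr0 mul0r addr0 -expr2.
Qed.

End AsymptoticExpansion.

(** * Explicit minimization on the positive half-line, and the derivative of the uniform density *)

Section Minimization.
Context {R : realType}.

Lemma powR_invnK (a : R) k : 0 <= a -> (a `^ (1 / k.+1%:R)) ^+ k.+1 = a.
Proof.
move=> a0; rewrite -powR_mulrn ?powR_ge0 // -powRrM mul1r mulVf ?pnatr_eq0 //.
exact: powRr1.
Qed.

Lemma powR_scale_invn (a b : R) k : 0 < a -> 0 < b ->
  let h := a `^ (1 / k.+1%:R) * b `^ (- (1 / k.+1%:R)) in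
  0 < h /\ h ^+ k.+1 = a / b.
Proof.
move=> a0 b0 h; split; first by rewrite mulr_gt0 // powR_gt0.
by rewrite exprMn powRN exprVn !powR_invnK // ltW.
Qed.

(** The linear coefficient is expressed through the critical point [h], so [h] is a double root of
    [M g - M h]; the remaining factor is positive. *)
Lemma optimal_quartic_linear (M : R -> R) (a c h : R) :
  0 < a -> 0 < h ->
  (forall g, 0 < g -> M g = a * g ^+ 4 - 4 * a * h ^+ 3 * g + c) ->
  is_optimal_bandwidth M h.
Proof.
move=> a0 h0 ME; split => // g g0 gh; rewrite !ME // -subr_gt0.
have -> : a * g ^+ 4 - 4 * a * h ^+ 3 * g + c
          - (a * h ^+ 4 - 4 * a * h ^+ 3 * h + c)
          = a * (g - h) ^+ 2 * (g ^+ 2 + 2 * h * g + 3 * h ^+ 2) by ring.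
have gh2 : 0 < (g - h) ^+ 2 by rewrite exprn_even_gt0 //= subr_eq0.
apply: mulr_gt0; first exact: mulr_gt0.
by rewrite !(addr_gt0, mulr_gt0, exprn_gt0).
Qed.

(** The same double-root factorization, after taking out 1 / g. *)
Lemma optimal_quartic_inverse (M : R -> R) (a h : R) :
  0 < a -> 0 < h ->
  (forall g, 0 < g -> M g = a * g ^+ 4 + 4 * a * h ^+ 5 / g) ->
  is_optimal_bandwidth M h.
Proof.
move=> a0 h0 ME; split => // g g0 gh; rewrite !ME // -subr_gt0.
have gN0 : g != 0 by rewrite gt_eqF.
have hN0 : h != 0 by rewrite gt_eqF.
have -> : a * g ^+ 4 + 4 * a * h ^+ 5 / g - (a * h ^+ 4 + 4 * a * h ^+ 5 / h)
   = a / g * (g - h) ^+ 2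
     * (g ^+ 3 + 2 * h * g ^+ 2 + 3 * h ^+ 2 * g + 4 * h ^+ 3).
  by field; rewrite gN0 hN0.
have gh2 : 0 < (g - h) ^+ 2 by rewrite exprn_even_gt0 //= subr_eq0.
apply: mulr_gt0; first by rewrite mulr_gt0 ?divr_gt0.
by rewrite !(addr_gt0, mulr_gt0, exprn_gt0).
Qed.

(** [f] is known only on [0, 1]; as [x] is interior, [f] is constant near [x], which determines the
    two-sided derivative. *)
Lemma derive1_uniform_density (f : R -> R) (x : R) :
  0 < x < 1 -> (forall t, I01 t -> f t = 1) -> derive1 f x = 0.
Proof.
move=> x01 f1; rewrite derive1E.
rewrite (@near_eq_derive _ _ _ f (cst 1)) ?derive_cst //.
have : open_nbhs x `]0, 1[%classic.
  by split; [exact: interval_open|rewrite /= in_itv].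
move=> /open_nbhs_nbhs; apply: filterS => t /=; rewrite in_itv /= => t01.
by rewrite f1 // /I01 /= in_itv /=; lra.
Qed.

End Minimization.

(** * The two optimal bandwidths, with integrals over the square *)

Section OptimalBandwidths.
Local Open Scope ring_scope.
Context {R : realType}.
Variables (K m f : R -> R) (rho : R -> R -> R) (p : nat) (nu : 'I_p.+1).
Variables (x : R) (n : nat).
Hypotheses (hK : kernel_assumption K) (n0 : (0 < n)%N).
Hypotheses (f'0 : derive1 f x = 0) (alpha0 : 0 < alpha rho x).
Local Notation mu := (kmoment K).

(** Both orders give the bias m'' mu_2 h ^ 2 / 2: for p = 0 it is the second-order term, since mu_1
    = 0; for p = 1 it is the leading term, the next one carrying mu_3 = 0. *)
Lemma optimal_bandwidth_regression :
  nu = 0%N :> nat -> p = 0%N \/ p = 1%N -> derive1n 2 m x != 0 ->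
  is_optimal_bandwidth (asymptotic_MSE K m f rho nu x n)
    ((alpha rho x / (2 * mu 2 ^+ 2 * derive1n 2 m x ^+ 2)
        * kernel_abs_moment K 0) `^ (1 / 3) * n%:R `^ (- (1 / 3))).
Proof.
move=> nu0 p01 m2N0.
have mu2 : 0 < mu 2 by exact: kernel_moment_gt0.
have J0 : 0 < kernel_abs_moment K 0 by exact: kernel_abs_moment0_gt0.
have nR : 0 < n%:R :> R by rewrite ltr0n.
have m22 : 0 < derive1n 2 m x ^+ 2 by rewrite exprn_even_gt0.
set b := _ * kernel_abs_moment K 0.
have b0 : 0 < b.
  apply: mulr_gt0 => //; apply: divr_gt0 => //.
  by rewrite mulr_gt0 // pmulr_rgt0 // exprn_gt0.
have [h0 h3] := powR_scale_invn 2 b0 nR.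
(* The coefficient is that of the squared bias; the constant is the part of the variance free of the
   bandwidth. *)
apply: (@optimal_quartic_linear _ _
  ((derive1n 2 m x * mu 2 / 2) ^+ 2) (rho x x / n%:R)) => //.
  by rewrite exprn_even_gt0 //= !mulf_neq0 // ?invr_neq0 // gt_eqF.
have nu1 : (nu <= 1)%N by rewrite nu0.
have pnu : (p <= nu.+1)%N by rewrite nu0; case: p01 => ->.
move=> g g0; rewrite h3 (asymptotic_MSE_uniform_design hK) //.
have mu0 := kernel_moment0 hK.
have mu1 : mu 1 = 0 by exact: kernel_moment_odd.
have mu3 : mu 3 = 0 by exact: kernel_moment_odd.
have gN0 : g != 0 by rewrite gt_eqF.
have muN0 : mu 2 != 0 by rewrite gt_eqF.
have nN0 : n%:R != 0 :> R by rewrite gt_eqF.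
have factE : (0`! = 1)%N * (1`! = 1)%N * (2`! = 2)%N * (3`! = 6)%N by [].
rewrite nu0.
(* The exponent is -1, so the variance correction is linear in [g]. *)
have -> : g ^ (2 * 0%:Z - 1) = g^-1 by [].
move: m2N0; rewrite /b; clear -mu0 mu1 mu3 gN0 muN0 nN0 factE p01.
case: p01 => ->; rewrite !(factE, muln0, addn0, subn0) mu0 ?mu1 ?mu3.
- generalize (derive1n 1 m x) (derive1n 2 m x) => m1 m2 m2N0.
  by field; do ?[apply/andP; split].
- generalize (derive1n 2 m x) (derive1n 3 m x) => m2 m3 m2N0.
  by field; do ?[apply/andP; split].
Qed.

(** Both orders give the bias m''' mu_4 h ^ 2 / (6 mu_2), from the second-order term for p = 1 and
    the leading one for p = 2. The rho term of the variance carries mu_1 ^ 2 = 0, which leaves a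
    multiple of 1 / h; mu_2 cancels in the quotient defining h ^ 5. *)
Lemma optimal_bandwidth_derivative :
  nu = 1%N :> nat -> p = 1%N \/ p = 2%N -> derive1n 3 m x != 0 ->
  is_optimal_bandwidth (asymptotic_MSE K m f rho nu x n)
    ((- (9 * alpha rho x / (2 * mu 4 ^+ 2 * derive1n 3 m x ^+ 2))
        * kernel_abs_moment K 1) `^ (1 / 5) * n%:R `^ (- (1 / 5))).
Proof.
move=> nu1 p12 m3N0.
have mu2 : 0 < mu 2 by exact: kernel_moment_gt0.
have mu4 : 0 < mu 4 by exact: kernel_moment_gt0.
have J1 : kernel_abs_moment K 1 < 0 by exact: kernel_abs_moment1_lt0.
have nR : 0 < n%:R :> R by rewrite ltr0n.
have m32 : 0 < derive1n 3 m x ^+ 2 by rewrite exprn_even_gt0.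
set b := _ * kernel_abs_moment K 1.
have b0 : 0 < b.
  (* The explicit minus sign compensates the negative double integral [J1]. *)
  rewrite nmulr_lgt0 // oppr_lt0; apply: divr_gt0; first exact: mulr_gt0.
  by rewrite mulr_gt0 // pmulr_rgt0 // exprn_gt0.
have [h0 h5] := powR_scale_invn 4 b0 nR.
apply: (@optimal_quartic_inverse _ _
  ((derive1n 3 m x * mu 4 / (6 * mu 2)) ^+ 2)) => //.
  by rewrite exprn_even_gt0 //= !mulf_neq0 // ?invr_neq0 ?mulf_neq0 // gt_eqF.
have nu_le1 : (nu <= 1)%N by rewrite nu1.
have pnu : (p <= nu.+1)%N by rewrite nu1; case: p12 => ->.
move=> g g0; rewrite h5 (asymptotic_MSE_uniform_design hK) //.
have mu1 : mu 1 = 0 by exact: kernel_moment_odd.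
have mu3 : mu 3 = 0 by exact: kernel_moment_odd.
have mu5 : mu 5 = 0 by exact: kernel_moment_odd.
have gN0 : g != 0 by rewrite gt_eqF.
have muN0 : mu 2 != 0 by rewrite gt_eqF.
have mu4N0 : mu 4 != 0 by rewrite gt_eqF.
have nN0 : n%:R != 0 :> R by rewrite gt_eqF.
have factE : (0`! = 1)%N * (1`! = 1)%N * (2`! = 2)%N * (3`! = 6)%N
             * (4`! = 24)%N by [].
rewrite nu1.
have -> : g ^ (2 * 1%:Z - 1) = g by [].
move: m3N0; rewrite /b; clear -mu1 mu3 mu5 gN0 muN0 mu4N0 nN0 factE p12.
case: p12 => ->; rewrite !(factE, muln1, addn1, subSS, subn0) mu1 ?mu3 ?mu5.
- generalize (derive1n 2 m x) (derive1n 3 m x) => m2 m3 m3N0.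
  by field; do ?[apply/andP; split].
- generalize (derive1n 3 m x) (derive1n 4 m x) => m3 m4 m3N0.
  by field; do ?[apply/andP; split].
Qed.

End OptimalBandwidths.

Theorem corollary4 (R : realType) (d : measure_display) (T : measurableType d)
  (P : probability T R)
  (m f : R -> R) (eps : nat -> R -> {RV P >-> R}) (rho : R -> R -> R)
  (xd : nat -> nat -> R)
  (Hf : sampling_density f)
  (Heps : error_model eps rho)
  (* "n, N -> oo" along an arbitrary joint regime (n k, N k) *)
  (n N : nat -> nat)
  (Hn1 : forall k, (0 < n k)%N) (HN1 : forall k, (1 < N k)%N)
  (Hn : n @ \oo --> \oo) (HN : N @ \oo --> \oo)
  (Hxd : forall k, design f (N k) (xd (N k)))
  (K : R -> R) (h : nat -> nat -> R) (p : nat) (nu : 'I_p.+1)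
  (x : R) (Hx : 0 < x < 1)
  (mhat : nat -> T -> R)
  (Hmhat : forall k w,
     is_locpoly_estimate K (N k) (xd (N k))
       (mean_observation m eps (n k) (xd (N k)) w) (h (n k) (N k)) nu x
       (mhat k w))
  (A1 : kernel_assumption K)
  (A2 : [/\ forall k, 0 < h (n k) (N k),
            h (n k) (N k) @[k --> \oo] --> (0 : R),
            (N k)%:R * h (n k) (N k) ^+ 2 @[k --> \oo] --> +oo &
            (n k)%:R * h (n k) (N k) ^+ (2 * nu) @[k --> \oo] --> +oo])
  (A3 : Cn_on I01 (p + 2) m)
  (A4 : forall t : R, I01 t -> f t = 1)
  (A5 : covariance_regularity rho)
  (Halpha : 0 < alpha rho x) :
  (nu = 0%N :> nat -> p = 0%N \/ p = 1%N ->
   derive1n 2 m x != 0 ->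
   (N k)%:R * (n k)%:R `^ (- (2 / 3)) @[k --> \oo] --> (+oo : set_system R) ->
   forall k,
     is_optimal_bandwidth (asymptotic_MSE K m f rho nu x (n k))
       ((alpha rho x / (2 * kmoment K 2 ^+ 2 * derive1n 2 m x ^+ 2)
         * plane_integral (fun u v => `|u - v| * K u * K v)) `^ (1 / 3)
        * (n k)%:R `^ (- (1 / 3))))
  /\
  (nu = 1%N :> nat -> p = 1%N \/ p = 2%N ->
   derive1n 3 m x != 0 ->
   (N k)%:R * (n k)%:R `^ (- (2 / 5)) @[k --> \oo] --> (+oo : set_system R) ->
   forall k,
     is_optimal_bandwidth (asymptotic_MSE K m f rho nu x (n k))
       ((- (9 * alpha rho x / (2 * kmoment K 4 ^+ 2 * derive1n 3 m x ^+ 2))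
         * plane_integral (fun u v => `|u - v| * (u * v) * K u * K v))
          `^ (1 / 5)
        * (n k)%:R `^ (- (1 / 5)))).
Proof.
have f'0 := derive1_uniform_density Hx A4.
split => nuE pE mN0 _ k.
  have -> : plane_integral (fun u v => `|u - v| * K u * K v)
            = kernel_abs_moment K 0.
    rewrite -(plane_integral_abs_moment A1); congr plane_integral.
    by apply/funext => u; apply/funext => v; rewrite !expr0 !mulr1.
  exact: optimal_bandwidth_regression.
(* [u ^+ 1] reduces to [u], so the integrand matches as it stands, whereas the zeroth powers above
   leave factors 1 to be removed. *)
rewrite (plane_integral_abs_moment A1 1).
exact: optimal_bandwidth_derivative.
Qed.
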